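(* Let $M$ be a smooth manifold and let $\tilde F$ be a (conic) metric on $M$, i.e. a positive function defined on a domain of $TM\setminus\{0\}$. Then $\tilde F$ is of $\tilde U$-Kropina type if and only if it solves the generalized Zermelo navigation problem on a Riemannian manifold $(M,h)$, with a ship's speed $|u(x)|_h$ varying in space, $0<|u(x)|_h\le 1$, in the presence of a strong wind $\tilde W(x)$ which satisfies $|\tilde W(x)|_h=|u(x)|_h$ for all $x\in M$.
   Context: For a Riemannian metric $h=h_{ij}\,dx^i\otimes dx^j$ on $M$ write $|y|_h^2=h(y,y)=h_{ij}y^iy^j$ for $y\in T_xM$, and for a vector field $\tilde W$ put $\tilde W_i=h_{ij}\tilde W^j$. $\tilde U$-Kropina metric: let $(M,h)$ be a Riemannian manifold and $\tilde W$ a globally defined smooth vector field on $M$ with $0<|\tilde W(x)|_h\le 1$ for all $x$ (so $\tilde W$ has no zeros). Let $\tilde k$ be a smooth function on $M$ and put $\tilde a_{ij}(x)=e^{-\tilde k(x)}h_{ij}(x)$, $\tilde b_i(x)=2e^{-\tilde k(x)}\tilde W_i(x)$, $\tilde\alpha(x,y)=\sqrt{\tilde a_{ij}(x)y^iy^j}$, $\tilde\beta(x,y)=\tilde b_i(x)y^i$. The Kropina metric $\tilde F=\tilde\alpha^2/\tilde\beta$, defined on the domain $\{(x,y)\in TM:\tilde\beta(x,y)>0\}$, is called a $\tilde U$-Kropina metric (it is of $\tilde U$-Kropina type). Generalized Zermelo navigation problem (strong wind case): the navigation data are a Riemannian metric $h$ on $M$, a space-dependent ship's speed $x\mapsto |u(x)|_h$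 (a smooth function with values in $(0,1]$, the $h$-norm of the ship's velocity $u$ relative to the surrounding sea), and a smooth wind vector field $\tilde W$ on $M$ with $|\tilde W(x)|_h=|u(x)|_h$. The ship's resultant velocity is $u+\tilde W$; directions with $u=-\tilde W$ are excluded. A metric $\tilde F$ solves the problem if it is the positive function whose indicatrix in each $T_xM$ is the $h$-sphere of radius $|u(x)|_h$ translated by $\tilde W(x)$ with the origin removed, i.e. if, on its domain $\{(x,y): h(y,\tilde W(x))>0\}$, it is the positive solution of $$\left|\frac{y}{\tilde F(x,y)}-\tilde W(x)\right|_h=|u(x)|_h .$$ (The $\tilde F$-length of a curve is then the travel time along it, and the time-minimal paths are the geodesics of $\tilde F$.) *)

(* Defs.v *)
From HB Require Import structures.
From mathcomp Require Import all_boot all_order all_algebra.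
From mathcomp Require Import all_classical all_reals all_analysis.

Set Implicit Arguments.
Unset Strict Implicit.
Unset Printing Implicit Defensive.

Import Order.TTheory GRing.Theory Num.Theory.
Import numFieldNormedType.Exports.

Local Open Scope classical_set_scope.
Local Open Scope ring_scope.

(* [Ck_on k U f]: on the open set [U] of R^n, all iterated partial derivatives
   of [f] of order at most [k] exist and are continuous. *)
Fixpoint Ck_on (R : realType) (n k : nat) (U : set 'rV[R]_n)
    (f : 'rV[R]_n -> R) : Prop :=
  (forall p, U p -> {for p, continuous f}) /\
  match k with
  | 0 => True
  | k'.+1 => forall a : 'I_n,
      (forall p, U p -> derivable f p (delta_mx 0 a)) /\
      Ck_on k' U (fun p => 'D_(delta_mx 0 a) f p)
  end.

Definition smooth_on (R : realType) (n : nat) (U : set 'rV[R]_n)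
    (f : 'rV[R]_n -> R) : Prop :=
  forall k, Ck_on k U f.

(* The values of [chart_map] outside [chart_dom], and of [chart_inv] outside
   [chart_map @` chart_dom], are irrelevant. *)
Record chart (R : realType) (n : nat) (M : topologicalType) := Chart {
  chart_dom : set M;
  chart_map : M -> 'rV[R]_n;
  chart_inv : 'rV[R]_n -> M;
  chart_dom_open : open chart_dom;
  chart_img_open : open (chart_map @` chart_dom);
  chart_mapK : forall x, chart_dom x -> chart_inv (chart_map x) = x;
  chart_map_continuous : {within chart_dom, continuous chart_map};
  chart_inv_continuous :
    {within chart_map @` chart_dom, continuous chart_inv}
}.

Definition chart_img (R : realType) (n : nat) (M : topologicalType)
    (c : chart R n M) : set 'rV[R]_n :=
  chart_map c @` chart_dom c.

Definition smooth_compatible (R : realType) (n : nat) (M : topologicalType)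
    (c d : chart R n M) : Prop :=
  forall b : 'I_n,
    smooth_on (chart_map c @` (chart_dom c `&` chart_dom d))
      (fun p => chart_map d (chart_inv c p) 0 b).

Record smooth_manifold (R : realType) (n : nat) := SmoothManifold {
  carrier :> topologicalType;
  manifold_hausdorff : hausdorff_space carrier;
  manifold_second_countable : @second_countable carrier;
  atlas_index : Type;
  atlas : atlas_index -> chart R n carrier;
  atlas_cover : forall x, exists i, chart_dom (atlas i) x;
  atlas_compatible : forall i j, smooth_compatible (atlas i) (atlas j)
}.

Section TangentSpace.
Context (R : realType) (n : nat) (M : smooth_manifold R n).

(* A tangent vector at [x] is the family of its coordinate vectors in all the
   charts around [x], related by the Jacobians of the changes of coordinates
   (row vectors: [v *m 'J f p] is the image of [v] under the differential of
   [f] at [p]).  Charts that do not contain [x] get the junk value 0. *)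
Definition is_tangent (x : M) (v : atlas_index M -> 'rV[R]_n) : Prop :=
  (forall i, ~ chart_dom (atlas i) x -> v i = 0) /\
  (forall i j, chart_dom (atlas i) x -> chart_dom (atlas j) x ->
     v j = v i *m 'J (chart_map (atlas j) \o chart_inv (atlas i))
                     (chart_map (atlas i) x)).

Definition tangent_pred (x : M) : {pred atlas_index M -> 'rV[R]_n} :=
  fun v => `[< is_tangent x v >].

Lemma tangent_pred_closed x : submod_closed (tangent_pred x).
Proof.
split=> [|a u v]; first by apply/asboolP; split=> [//|i j _ _]; rewrite mul0mx.
move=> /asboolP[u0 uJ] /asboolP[v0 vJ]; apply/asboolP.
have E i : (a *: u + v) i = a *: u i + v i by [].
split=> [i xi|i j xi xj]; first by rewrite E u0// v0// scaler0 addr0.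
by rewrite !E (uJ _ _ xi xj) (vJ _ _ xi xj) mulmxDl scalemxAl.
Qed.

HB.instance Definition _ x :=
  GRing.isSubmodClosed.Build R (atlas_index M -> 'rV[R]_n) (tangent_pred x)
    (tangent_pred_closed x).

Record tangent (x : M) := Tangent {
  coords :> atlas_index M -> 'rV[R]_n;
  coordsP : coords \in tangent_pred x
}.

HB.instance Definition _ x := [isSub for @coords x].
HB.instance Definition _ x := [Choice of tangent x by <:].
HB.instance Definition _ x := [SubChoice_isSubLmodule of tangent x by <:].

End TangentSpace.

Section Tensors.
Context (R : realType) (n : nat) (M : smooth_manifold R n).

Definition smooth_function (f : M -> R) : Prop :=
  forall i, smooth_on (chart_img (atlas i)) (fun p => f (chart_inv (atlas i) p)).

Definition smooth_vector_field (W : forall x : M, tangent x) : Prop :=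
  forall (i : atlas_index M) (a : 'I_n),
    smooth_on (chart_img (atlas i))
      (fun p => W (chart_inv (atlas i) p) i 0 a).

(* [metric_smooth]: in each chart, [h = h_ab dx^a (x) dx^b] with smooth
   components [h_ab], given as functions of the coordinates. *)
Record riemannian_metric := RiemannianMetric {
  metric :> forall x : M, tangent x -> tangent x -> R;
  metric_sym : forall x (v w : tangent x), metric v w = metric w v;
  metric_linear : forall x (v : tangent x), scalar (metric v);
  metric_pos : forall x (v : tangent x), v != 0 -> 0 < metric v v;
  metric_smooth : forall i : atlas_index M,
    exists g : 'I_n -> 'I_n -> 'rV[R]_n -> R,
      (forall a b, smooth_on (chart_img (atlas i)) (g a b)) /\
      (forall x (v w : tangent x), chart_dom (atlas i) x ->
         metric v w = \sum_(a < n) \sum_(b < n)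
           g a b (chart_map (atlas i) x) * v i 0 a * w i 0 b)
}.

Definition metric_norm (h : riemannian_metric) (x : M) (v : tangent x) : R :=
  Num.sqrt (h x v v).

(* Openness in TM, read in the bundle charts [(x, y) |-> (phi x, dphi y)]. *)
Definition tangent_bundle_open (D : forall x : M, set (tangent x)) : Prop :=
  forall i : atlas_index M,
    open [set pq : 'rV[R]_n * 'rV[R]_n |
      chart_img (atlas i) pq.1 /\
      exists2 y : tangent (chart_inv (atlas i) pq.1),
        D (chart_inv (atlas i) pq.1) y & y i = pq.2].

(* A positive function on an open subset of TM minus the zero section; its
   values outside [cm_dom] are junk.  Invariance of the domain under positive
   scaling, homogeneity and smoothness are not required. *)
Record conic_metric := ConicMetric {
  cm_dom : forall x : M, set (tangent x);
  cm_fun :> forall x : M, tangent x -> R;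
  cm_dom_open : tangent_bundle_open cm_dom;
  cm_dom_neq0 : forall x (y : tangent x), cm_dom y -> y != 0;
  cm_pos : forall x (y : tangent x), cm_dom y -> 0 < cm_fun y
}.

Section Kropina.
Variables (h : riemannian_metric) (W : forall x : M, tangent x) (k : M -> R).

Definition kropina_a (x : M) (y z : tangent x) : R := expR (- k x) * h x y z.

Definition kropina_alpha (x : M) (y : tangent x) : R :=
  Num.sqrt (kropina_a y y).

Definition kropina_beta (x : M) (y : tangent x) : R :=
  2 * expR (- k x) * h x (W x) y.

End Kropina.

Definition U_kropina_type (F : conic_metric) : Prop :=
  exists (h : riemannian_metric) (W : forall x : M, tangent x) (k : M -> R),
    [/\ smooth_vector_field W,
        (forall x, 0 < metric_norm h (W x) <= 1),
        smooth_function k,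
        (forall x (y : tangent x), cm_dom F y <-> 0 < kropina_beta h W k y) &
        (forall x (y : tangent x), cm_dom F y ->
           F x y = kropina_alpha h k y ^+ 2 / kropina_beta h W k y)].

(* [s] is the ship's speed |u|_h and [W] the wind, with |W|_h = |u|_h. *)
Definition solves_strong_zermelo (h : riemannian_metric) (s : M -> R)
    (W : forall x : M, tangent x) (F : conic_metric) : Prop :=
  (forall x (y : tangent x), cm_dom F y <-> 0 < h x y (W x)) /\
  (forall x (y : tangent x), cm_dom F y ->
     [/\ 0 < F x y,
         metric_norm h ((F x y)^-1 *: y - W x) = s x &
         forall t : R, 0 < t ->
           metric_norm h (t^-1 *: y - W x) = s x -> t = F x y]).

End Tensors.

(* Main.v *)
Require Import Defs.
From mathcomp Require Import all_boot all_order all_algebra.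
From mathcomp Require Import all_classical all_reals all_analysis.
From mathcomp Require Import ring lra.

Set Implicit Arguments.
Unset Strict Implicit.
Unset Printing Implicit Defensive.

Import Order.TTheory GRing.Theory Num.Theory.
Import numFieldNormedType.Exports.

Local Open Scope classical_set_scope.
Local Open Scope ring_scope.

(** Fix a point [x] and vectors [y], [w] with [h(y, w) > 0].  For [t > 0],
    expanding the square gives
      [|y / t - w|^2 = h(y, y) / t^2 - 2 h(y, w) / t + |w|^2],
    so that [|y / t - w| = |w|] holds exactly when [t = h(y, y) / (2 h(y, w))]
    ([zermelo_time]).  The strong wind makes the quadratic equation for the
    travel time degenerate to a linear one, whose only solution is the Kropina
    quotient: the conformal factor [exp (- k)] occurs in both [alpha ^ 2] and
    [beta], hence cancels ([kropinaE]) and does not change the sign of [beta]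
    ([kropina_beta_gt0]).  The two descriptions thus hold for the same metric
    [h] and the same field [W], with ship's speed [|W|_h] in one direction and
    [k = 0] in the other.

    What remains is that the ship's speed [|W|_h] is a smooth function
    ([smooth_metric_norm]).  In a chart it is the square root of a polynomial in
    the components of [h] and [W], positive because [W] has no zeros; so it
    suffices that functions with continuous partial derivatives of order at most
    [k] are closed under sums, products and, for positive functions, real
    powers. *)

(** * Partial derivatives of a composite *)

Section ChainRule.
Context (R : realType) (V : normedModType R).

(** The difference quotients of [f] at [p] along [v] are those of the restriction
    of [f] to the line through [p] with direction [v].  Partial derivatives thus
    reduce to one variable, where the chain rule needs no total
    differentiability. *)
Lemma is_derive_line (f : V -> R) (p v : V) (df : R) :
  is_derive p v f df <-> is_derive (0 : R) 1 (fun t : R => f (t *: v + p)) df.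
Proof.
have DE : 'D_v f p = 'D_1 (fun t : R => f (t *: v + p)) 0.
  rewrite /derive; set q1 := fun t : R => t^-1 *: _.
  set q2 := fun t : R => t^-1 *: _; suff -> : q1 = q2 by [].
  by apply/funext => t; rewrite /q1 /q2 /= addr0 scale0r add0r [t%:A]mulr1.
split=> -[fv fE]; split.
- exact: (derivable1P f p v).1.
- by rewrite -DE.
- exact: (derivable1P f p v).2.
- by rewrite DE.
Qed.

Lemma is_derive_comp (g : R -> R) (f : V -> R) (p v : V) (dg df : R) :
  is_derive (f p) 1 g dg -> is_derive p v f df ->
  is_derive p v (g \o f) (dg * df).
Proof.
move=> gP /is_derive_line fP; apply/is_derive_line.
by apply: (is_derive1_comp _ fP); rewrite scale0r add0r.
Qed.

End ChainRule.

(** * Closure properties of functions of class C^k *)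

Section SmoothOn.
Context (R : realType) (n : nat) (U : set 'rV[R]_n) (U_open : open U).
Implicit Types f g : 'rV[R]_n -> R.

(** As [U] is open, two functions equal on [U] agree near each point of [U], so
    their partial derivatives agree on [U] as well. *)
Lemma Ck_on_ext k f g :
  (forall p, U p -> f p = g p) -> Ck_on k U f -> Ck_on k U g.
Proof.
elim: k f g => [|k IH] f g fg [fC fD];
  have fgN p : U p -> \forall q \near p, f q = g q by
    [move=> Up; near do apply: fg; exact: open_nbhs_nbhs];
  (split=> [p Up|]; first by
    rewrite /prop_for /continuous_at -(fg p Up);
    apply: cvg_trans (fC p Up); exact: near_eq_cvg (fgN p Up)) => //.
move=> a; have [fa fk] := fD a; split=> [p Up|].
  exact: near_eq_derivable (fgN p Up) (fa p Up).
by apply: IH fk => p Up; exact: near_eq_derive (fgN p Up).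
Unshelve. all: by end_near.
Qed.

Lemma Ck_onS k f : Ck_on k.+1 U f -> Ck_on k U f.
Proof.
elim: k f => [|k IH] f [fC fD]; split=> // a.
by have [fa fk] := fD a; split=> //; exact: IH.
Qed.

(** This lets the partial derivatives be given by any formula valid on [U]; outside
    [U] the formulas of the calculus rules may fail. *)
Lemma Ck_on_is_derive k f (df : 'I_n -> 'rV[R]_n -> R) :
  (forall p, U p -> {for p, continuous f}) ->
  (forall a p, U p -> is_derive p (delta_mx 0 a) f (df a p)) ->
  (forall a, Ck_on k U (df a)) -> Ck_on k.+1 U f.
Proof.
move=> fC fD dfk; split=> // a; split=> [p /(fD a)[]//|].
by apply: Ck_on_ext (dfk a) => p /(fD a)[_ ->].
Qed.

Lemma Ck_on_derive k f a p : Ck_on k.+1 U f -> U p ->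
  is_derive p (delta_mx 0 a) f ('D_(delta_mx 0 a) f p).
Proof. by move=> [_ /(_ a)[fa _]] Up; split=> //; exact: fa. Qed.

Lemma Ck_on_cst k (c : R) : Ck_on k U (cst c).
Proof.
elim: k c => [|k IH] c; first by split=> // p _; exact: cst_continuous.
apply: (@Ck_on_is_derive _ _ (fun _ => cst 0)) => // p _.
exact: cst_continuous.
Qed.

Lemma Ck_onD k f g : Ck_on k U f -> Ck_on k U g ->
  Ck_on k U (fun p => f p + g p).
Proof.
elim: k f g => [|k IH] f g fk gk; have [fC fD] := fk; have [gC gD] := gk.
  by split=> // p Up; exact: (continuousD (fC p Up) (gC p Up)).
apply: (@Ck_on_is_derive _ _ (fun a p =>
  'D_(delta_mx 0 a) f p + 'D_(delta_mx 0 a) g p)).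
- by move=> p Up; exact: (continuousD (fC p Up) (gC p Up)).
- by move=> a p Up; apply: is_deriveD; apply: Ck_on_derive.
- by move=> a; apply: IH; [case: (fD a)|case: (gD a)].
Qed.

Lemma Ck_onM k f g : Ck_on k U f -> Ck_on k U g ->
  Ck_on k U (fun p => f p * g p).
Proof.
elim: k f g => [|k IH] f g fk gk; have [fC fD] := fk; have [gC gD] := gk.
  by split=> // p Up; exact: (continuousM (fC p Up) (gC p Up)).
apply: (@Ck_on_is_derive _ _ (fun a p =>
  f p * 'D_(delta_mx 0 a) g p + g p * 'D_(delta_mx 0 a) f p)).
- by move=> p Up; exact: (continuousM (fC p Up) (gC p Up)).
- by move=> a p Up; apply: is_deriveM; apply: Ck_on_derive.
- move=> a; apply: Ck_onD; apply: IH; try exact: Ck_onS.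
    by case: (gD a).
  by case: (fD a).
Qed.

Lemma Ck_on_sum k (I : Type) (r : seq I) (F : I -> 'rV[R]_n -> R) :
  (forall i, Ck_on k U (F i)) -> Ck_on k U (fun p => \sum_(i <- r) F i p).
Proof.
move=> Fk; elim: r => [|i r IH].
  by apply: Ck_on_ext (Ck_on_cst k 0) => p _; rewrite big_nil.
by apply: Ck_on_ext (Ck_onD (Fk i) IH) => p _; rewrite big_cons.
Qed.

(** Each derivative is a product with a factor [f `^ (e - 1)], so the induction on
    [k] closes for all exponents [e] at once, whereas the square root alone would
    call for a separate treatment of its inverse. *)
Lemma Ck_on_powR k (e : R) f : (forall p, U p -> 0 < f p) ->
  Ck_on k U f -> Ck_on k U (fun p => f p `^ e).
Proof.
move=> f0; have fpC : (forall p, U p -> {for p, continuous f}) ->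
    forall e' p, U p -> {for p, continuous (fun q => f q `^ e')}.
  move=> fC e' p Up; apply: (@continuous_comp _ _ _ f (@powR R ^~ e')).
    exact: fC.
  apply/differentiable_continuous/derivable1_diffP.
  by have [] := is_derive1_powR e' (f0 p Up).
elim: k e => [|k IH] e fk; have [fC fD] := fk; first by split=> //; exact: fpC.
apply: (@Ck_on_is_derive _ _ (fun a p =>
  e * f p `^ (e - 1) * 'D_(delta_mx 0 a) f p)).
- exact: fpC.
- move=> a p Up; apply: (is_derive_comp (is_derive1_powR e (f0 p Up))).
  exact: Ck_on_derive fk Up.
- move=> a; apply: Ck_onM; last by case: (fD a).
  by apply: Ck_onM; [exact: Ck_on_cst|exact/IH/Ck_onS].
Qed.

Lemma smooth_on_sqrt f : (forall p, U p -> 0 < f p) ->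
  smooth_on U f -> smooth_on U (fun p => Num.sqrt (f p)).
Proof.
move=> f0 fS k; apply: Ck_on_ext (Ck_on_powR 2^-1 f0 (fS k)) => p Up.
by rewrite powR12_sqrt// ltW// f0.
Qed.

End SmoothOn.

(** * Riemannian norms and the travel time *)

Section Metric.
Context (R : realType) (n : nat) (M : smooth_manifold R n).
Context (h : riemannian_metric M).

Lemma smooth_cst (c : R) : smooth_function (fun _ : M => c).
Proof. by move=> i k; apply: Ck_on_cst; exact: chart_img_open. Qed.

(** Zeros of [W] have to be excluded because the square root is not smooth at
    0. *)
Lemma smooth_metric_norm (W : forall x : M, tangent x) :
  smooth_vector_field W -> (forall x, 0 < metric_norm h (W x)) ->
  smooth_function (fun x => metric_norm h (W x)).
Proof.
move=> WS W0 i; have imgO : open (chart_img (atlas i)) by exact: chart_img_open.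
apply: smooth_on_sqrt => // [p _|k]; first by rewrite -sqrtr_gt0 W0.
have [g [gS hE]] := metric_smooth h i.
apply: (@Ck_on_ext _ _ _ imgO _ (fun p => \sum_(a < n) \sum_(b < n)
    g a b p * W (chart_inv (atlas i) p) i 0 a
            * W (chart_inv (atlas i) p) i 0 b)).
  by move=> _ [x xi <-]; rewrite chart_mapK// hE.
apply: Ck_on_sum => // a; apply: Ck_on_sum => // b.
by do 2?apply: Ck_onM => //; [exact: gS|exact: WS|exact: WS].
Qed.

Section Point.
Context (x : M).
Implicit Types v w y : tangent x.

Lemma metricDr a v w y : h x y (a *: v + w) = a * h x y v + h x y w.
Proof. exact: metric_linear. Qed.

Lemma metric0r v : h x v 0 = 0.
Proof. by have := metricDr 1 0 0 v; rewrite scale1r addr0 mul1r; lra. Qed.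

Lemma metric_ge0 v : 0 <= h x v v.
Proof.
have [->|v0] := eqVneq v 0; first by rewrite metric0r.
exact/ltW/metric_pos.
Qed.

Lemma metric_sqr_subZ c y w :
  h x (c *: y - w) (c *: y - w) = c ^+ 2 * h x y y - 2 * c * h x y w + h x w w.
Proof.
have subE v : h x v (c *: y - w) = c * h x v y - h x v w.
  rewrite metricDr -[- w]addr0 -scaleN1r metricDr metric0r; ring.
rewrite subE (Defs.metric_sym h _ y) (Defs.metric_sym h _ w) !subE (Defs.metric_sym h w y).
ring.
Qed.

(** Both sides of the equation contain [|w|^2]; once these cancel, a factor
    [1 / t^2] splits off, leaving the linear equation
    [h(y, y) = 2 t h(y, w)]. *)
Lemma zermelo_time y w (t : R) : 0 < t -> 0 < h x y w ->
  metric_norm h (t^-1 *: y - w) = metric_norm h w <->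
  t = h x y y / (2 * h x y w).
Proof.
move=> t0 yw0; have tN0 := lt0r_neq0 t0; have ywN0 := lt0r_neq0 yw0.
have -> : metric_norm h (t^-1 *: y - w) = metric_norm h w <->
    h x (t^-1 *: y - w) (t^-1 *: y - w) = h x w w.
  split=> [|hE]; last by rewrite /metric_norm hE.
  by move=> /(congr1 (fun r => r ^+ 2)); rewrite !sqr_sqrtr// metric_ge0.
rewrite metric_sqr_subZ; split=> [hE|->]; last first.
  have yyN0 : h x y y != 0.
    apply: lt0r_neq0; apply: metric_pos; apply: contraTneq yw0 => ->.
    by rewrite Defs.metric_sym metric0r ltxx.
  by field; rewrite yyN0 ywN0.
have : t^-1 ^+ 2 * (h x y y - 2 * t * h x y w) = 0.
  apply: (@addIr _ (h x w w)); rewrite add0r -[RHS]hE; field; exact: tN0.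
move=> /eqP; rewrite mulf_eq0 expf_eq0 invr_eq0 (negPf tN0) /= => /eqP yyE.
have -> : h x y y = t * (2 * h x y w) by lra.
by rewrite mulfK// mulf_neq0// pnatr_eq0.
Qed.

End Point.

(** * The Kropina metric *)

Context (W : forall x : M, tangent x) (k : M -> R).

Lemma kropina_beta_gt0 x (y : tangent x) :
  (0 < kropina_beta h W k y) = (0 < h x y (W x)).
Proof.
by rewrite /kropina_beta Defs.metric_sym pmulr_rgt0// mulr_gt0// expR_gt0.
Qed.

Lemma kropinaE x (y : tangent x) :
  kropina_alpha h k y ^+ 2 / kropina_beta h W k y =
  h x y y / (2 * h x y (W x)).
Proof.
rewrite sqr_sqrtr; last by rewrite mulr_ge0 ?expR_ge0 ?metric_ge0.
rewrite /kropina_a /kropina_beta (Defs.metric_sym h (W x)).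
rewrite -[2 * _ * _]mulrA [2 * (_ * _)]mulrCA -mulf_div divff ?mul1r//.
by rewrite gt_eqF// expR_gt0.
Qed.

End Metric.

Theorem proposition2p3 (R : realType) (n : nat) (M : smooth_manifold R n)
    (F : conic_metric M) :
  U_kropina_type F <->
  exists (h : riemannian_metric M) (s : M -> R) (W : forall x : M, tangent x),
    [/\ smooth_function s,
        (forall x, 0 < s x <= 1),
        smooth_vector_field W,
        (forall x, metric_norm h (W x) = s x) &
        solves_strong_zermelo h s W F].
Proof.
split=> [[h [W [k [WS W01 kS Fdom FE]]]]|[h [s [W [sS s01 WS Ws [Fdom FP]]]]]].
- have dom x (y : tangent x) : cm_dom F y <-> 0 < h x y (W x).
    by rewrite Fdom kropina_beta_gt0.
  exists h, (fun x => metric_norm h (W x)), W; split=> //.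
    by apply: smooth_metric_norm => // x; case/andP: (W01 x).
  split=> // x y Dy; have /dom yW := Dy; have F0 := cm_pos Dy.
  have FyE : F x y = h x y y / (2 * h x y (W x)) by rewrite FE// kropinaE.
  split=> //; first exact/zermelo_time.
  by move=> t t0 /zermelo_time; rewrite FyE; apply.
- exists h, W, (fun=> 0); split=> //.
  + by move=> x; rewrite Ws.
  + exact: smooth_cst.
  + by move=> x y; rewrite Fdom kropina_beta_gt0.
  + move=> x y Dy; have /Fdom yW := Dy; have [F0 FW _] := FP x y Dy.
    by rewrite kropinaE; apply/zermelo_time => //; rewrite Ws.
Qed.
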